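(* Let $K$, $L$ and $H$ be finite dimensional complex Hilbert spaces. Let $\mathcal{C}$ be a symmetric mapping cone in $P(H)$. Suppose the linear map $\psi\colon B(K)\to B(H)$ is $\mathcal{C}$-positive and the linear map $\phi\colon B(L)\to B(H)$ is $\mathcal{C}^{o}$-positive. Then $\psi\otimes\phi\colon B(K\otimes L)\to B(H\otimes H)$ is positive.
   Context: $B(H)$ denotes the linear operators on $H$, with $n=\dim H<\infty$; $Tr$ is the usual trace. Fix an orthonormal basis $e_1,\dots,e_n$ of $H$ with matrix units $e_{ij}\in B(H)$, $e_{ij}e_k=\delta_{jk}e_i$; $t$ (also $b\mapsto b^t$) is the transpose map on $B(H)$ with respect to this basis. $B(K\otimes H)$ is identified with $B(K)\otimes B(H)$, and similarly for other pairs. A linear map is positive if it sends positive semidefinite operators to positive semidefinite operators. $P(H)$ is the cone of positive linear maps $B(H)\to B(H)$, and $CP(H)\subset P(H)$ is the set of completely positive ones. For a linear map $\phi\colon B(H)\to B(H)$, its adjoint $\phi^*$ is defined by $Tr(\phi(a)b)=Tr(a\phi^*(b))$ for $a,b\in B(H)$, and $\phi^t=t\circ\phi\circ t$. The Choi matrix of such a $\phi$ is $C_\phi=\sum_{i,j}e_{ij}\otimes\phi(e_{ij})$. A mapping cone is a closed subcone $\mathcal{C}$ of $P(H)$ such that if $\phi\in\mathcal{C}$ and $\alpha,\beta\in CP(H)$ then $\alpha\circ\phi\in\mathcal{C}$ and $\phi\circ\beta\in\mathcal{C}$. It is symmetric if $\phi\in\mathcal{C}\iff\phi^*\in\mathcal{C}\iff\phi^t\in\mathcal{C}$.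 The dual cone of $\mathcal{C}$ is $\mathcal{C}^{o}=\{\phi\in P(H): Tr(C_\phi C_\psi)\geq 0\ \text{for all }\psi\in\mathcal{C}\}$; when $\mathcal{C}$ is symmetric, $\mathcal{C}^{o}$ is also a symmetric mapping cone (a known result). For a linear map $\phi\colon B(K)\to B(H)$, let $\widetilde{\phi}$ be the linear functional on $B(K)\otimes B(H)$ with $\widetilde{\phi}(a\otimes b)=Tr(\phi(a)b^t)$. For a mapping cone $\mathcal{C}$ in $P(H)$, $\phi$ is called $\mathcal{C}$-positive if $\widetilde{\phi}(x)\ge 0$ for every $x$ in the cone $\{x\in B(K\otimes H): (\iota\otimes\alpha)(x)\geq 0\ \text{for all }\alpha\in\mathcal{C}\}$, where $\iota$ is the identity map on $B(K)$. (The same definition applies with $L$ in place of $K$ and $\mathcal{C}^{o}$ in place of $\mathcal{C}$.) *)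

(* Defs.v *)
(* Operators on a d-dimensional complex Hilbert space are d x d matrices, the
   standard basis being the fixed orthonormal basis.  B(K (x) H) is
   'M_(k * h), with the index bijection mxtens_index and the tensor product
   tensmx (a *t b) of mathcomp.real_closed.mxtens.  Definitions are over an
   arbitrary numClosedFieldType C, which carries the topology of its norm; the
   intended instance is C := R[i] with R : realType. *)
From HB Require Import structures.
From mathcomp Require Import all_boot all_order all_algebra.
From mathcomp Require Import all_classical all_reals all_analysis.
From mathcomp Require Import mxtens ring.
Set Implicit Arguments.
Unset Strict Implicit.
Unset Printing Implicit Defensive.
Import Order.TTheory GRing.Theory Num.Theory.
Import numFieldNormedType.Exports.
Local Open Scope classical_set_scope.
Local Open Scope ring_scope.

Section Maps.
Context {C : numClosedFieldType}.

(* In the order of C, [0 <= z] says that z is real and nonnegative, so psd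
   implies hermitian. *)
Definition psd d (a : 'M[C]_d) : Prop :=
  forall v : 'cV[C]_d, 0 <= (map_mx Num.conj v^T *m a *m v) 0 0.

Definition positive_map m n (f : 'M[C]_m -> 'M[C]_n) : Prop :=
  forall a, psd a -> psd (f a).

(* f (x) g, by linear extension from the matrix units; see [tensor_map_tens]. *)
Definition tensor_map m n p q (f : 'M[C]_m -> 'M[C]_n) (g : 'M[C]_p -> 'M[C]_q)
    (x : 'M[C]_(m * p)) : 'M[C]_(n * q) :=
  \sum_(i < m) \sum_(j < m) \sum_(r < p) \sum_(s < p)
    x (mxtens_index (i, r)) (mxtens_index (j, s)) *:
      (f (delta_mx i j) *t g (delta_mx r s)).

(* The functional a (x) b |-> Tr (f a * b^T), by linear extension from the
   matrix units; see [dual_functional_tens]. *)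
Definition dual_functional k h (f : 'M[C]_k -> 'M[C]_h) (x : 'M[C]_(k * h)) : C :=
  \sum_(i < k) \sum_(j < k) \sum_(r < h) \sum_(s < h)
    x (mxtens_index (i, r)) (mxtens_index (j, s)) *
      \tr (f (delta_mx i j) *m (delta_mx r s)^T).

Definition choi h (f : 'M[C]_h -> 'M[C]_h) : 'M[C]_(h * h) :=
  \sum_(i < h) \sum_(j < h) (delta_mx i j *t f (delta_mx i j)).

(* For linear f, the unique map with Tr (f a * b) = Tr (a * f^* b); see
   [mxtrace_adjoint_map]. *)
Definition adjoint_map h (f : 'M[C]_h -> 'M[C]_h) (b : 'M[C]_h) : 'M[C]_h :=
  \matrix_(i, j) \tr (f (delta_mx j i) *m b).

Definition transpose_map h (f : 'M[C]_h -> 'M[C]_h) (a : 'M[C]_h) : 'M[C]_h :=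
  (f a^T)^T.

Definition posmaps h : set ('M[C]_h -> 'M[C]_h) :=
  [set f | linear f /\ positive_map f].

Definition cpmaps h : set ('M[C]_h -> 'M[C]_h) :=
  [set f | linear f /\
    forall m, positive_map (tensor_map (@id 'M[C]_m) f)].

(* Closedness is for pointwise convergence, which on the finite-dimensional
   space of linear maps is the usual topology. *)
Definition mapping_cone h (D : set ('M[C]_h -> 'M[C]_h)) : Prop :=
  [/\ D `<=` @posmaps h,
      closed (D : set {ptws 'M[C]_h -> 'M[C]_h}),
      D (fun=> 0),
      (forall f g, D f -> D g -> D (fun a => f a + g a)) &
      (forall (c : C) f, 0 <= c -> D f -> D (fun a => c *: f a))] /\
  (forall f g, D f -> cpmaps g -> D (g \o f) /\ D (f \o g)).

Definition symmetric_cone h (D : set ('M[C]_h -> 'M[C]_h)) : Prop :=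
  forall f, linear f ->
    (D f <-> D (adjoint_map f)) /\ (D f <-> D (transpose_map f)).

Definition dual_cone h (D : set ('M[C]_h -> 'M[C]_h)) :
    set ('M[C]_h -> 'M[C]_h) :=
  [set f | posmaps f /\ forall g, D g -> 0 <= \tr (choi f *m choi g)].

Definition cone_positive k h (D : set ('M[C]_h -> 'M[C]_h))
    (f : 'M[C]_k -> 'M[C]_h) : Prop :=
  forall x : 'M[C]_(k * h),
    (forall g, D g -> psd (tensor_map (@id 'M[C]_k) g x)) ->
    0 <= dual_functional f x.

Let linear_delta m n (f : {linear 'M[C]_m -> 'M[C]_n}) a :
  f a = \sum_i \sum_j a i j *: f (delta_mx i j).
Proof.
rewrite {1}[a]matrix_sum_delta linear_sum; apply: eq_bigr => i _.
by rewrite linear_sum; apply: eq_bigr => j _; rewrite linearZ.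
Qed.

Lemma tensor_map_linear m n p q (f : 'M[C]_m -> 'M[C]_n)
  (g : 'M[C]_p -> 'M[C]_q) : linear (tensor_map f g).
Proof.
move=> c x y; rewrite /tensor_map.
do 4 (rewrite scaler_sumr -big_split; apply: eq_bigr => ? _ /=).
by rewrite !mxE scalerDl scalerA.
Qed.

Lemma tensor_map_tens m n p q (f : {linear 'M[C]_m -> 'M[C]_n})
    (g : {linear 'M[C]_p -> 'M[C]_q}) a b :
  tensor_map f g (a *t b) = f a *t g b.
Proof.
rewrite (linear_delta f a) (linear_delta g b).
apply/matrixP => u v; rewrite !mxE !summxE mulr_suml.
apply: eq_bigr => i _; rewrite !summxE mulr_suml; apply: eq_bigr => j _.
rewrite !summxE mulr_sumr; apply: eq_bigr => r _.
rewrite !summxE mulr_sumr; apply: eq_bigr => s _.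
by rewrite !mxE !mxtens_indexK /=; ring.
Qed.

Lemma dual_functional_linear k h (f : 'M[C]_k -> 'M[C]_h) :
  scalar (dual_functional f).
Proof.
move=> c x y; rewrite /dual_functional.
do 4 (rewrite mulr_sumr -big_split; apply: eq_bigr => ? _ /=).
by rewrite !mxE mulrDl mulrA.
Qed.

Lemma dual_functional_tens k h (f : {linear 'M[C]_k -> 'M[C]_h}) a b :
  dual_functional f (a *t b) = \tr (f a *m b^T).
Proof.
rewrite (linear_delta f a) {2}[b]matrix_sum_delta mulmx_suml raddf_sum.
apply: eq_bigr => i _; rewrite mulmx_suml raddf_sum; apply: eq_bigr => j _ /=.
rewrite linear_sum mulmx_sumr raddf_sum; apply: eq_bigr => r _ /=.
rewrite linear_sum mulmx_sumr raddf_sum; apply: eq_bigr => s _ /=.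
by rewrite linearZ /= -scalemxAr -scalemxAl !mxtraceZ !mxE !mxtens_indexK /=; ring.
Qed.

Lemma mxtrace_adjoint_map h (f : {linear 'M[C]_h -> 'M[C]_h}) a b :
  \tr (f a *m b) = \tr (a *m adjoint_map f b).
Proof.
rewrite (linear_delta f a) mulmx_suml raddf_sum; apply: eq_bigr => i _ /=.
rewrite mulmx_suml raddf_sum mxE; apply: eq_bigr => j _ /=.
by rewrite -scalemxAl mxtraceZ !mxE.
Qed.

End Maps.

(* Main.v *)
(* For rank-one z = v v^* and a vector w of H (x) H, <w, (psi (x) phi)(z) w> is
   linear in phi, hence is the dual functional of phi at some X built from psi,
   so it suffices that <u, (id (x) g)(X) u> >= 0 for g in the dual cone D^o.
   This is linear in psi, hence is the dual functional of psi at some Y built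
   from g, so it suffices that <p, (id (x) f)(Y) p> >= 0 for f in D.  That
   number is Tr (C_g C_f') with f' = Ad_{T^*} o f^t o Ad_W, which lies in D
   since D is invariant under transposition and under composition with
   completely positive maps; here W is w read as a matrix. *)
Require Import Defs.
From HB Require Import structures.
From mathcomp Require Import all_boot all_order all_algebra.
From mathcomp Require Import all_classical all_reals all_analysis.
From mathcomp Require Import complex mxtens ring.
Set Implicit Arguments.
Unset Strict Implicit.
Unset Printing Implicit Defensive.
Import Order.TTheory GRing.Theory Num.Theory.
Import numFieldNormedType.Exports.
Local Open Scope classical_set_scope.
Local Open Scope ring_scope.

Section MappingCones.
Context {C : numClosedFieldType}.

Local Notation idx := mxtens_index.
Local Notation "A ^h" := (map_mx (@Num.conj C) A^T) (at level 1, format "A ^h").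

(** * Sesquilinear forms and rank-one decomposition of psd matrices *)

Definition qform d (a : 'M[C]_d) (u v : 'cV[C]_d) : C := (u^h *m a *m v) 0 0.

Lemma qformE d (a : 'M[C]_d) u v :
  qform a u v = \sum_(p : 'I_d * 'I_d) (u p.1 0)^* * a p.1 p.2 * v p.2 0.
Proof.
rewrite /qform mxE -(pair_bigA _ (fun i j => (u i 0)^* * a i j * v j 0)) /=.
rewrite exchange_big; apply: eq_bigr => j _; rewrite mxE mulr_suml.
by apply: eq_bigr => i _; rewrite !mxE.
Qed.

Lemma adjmxM m n p (a : 'M[C]_(m, n)) (b : 'M[C]_(n, p)) :
  (a *m b)^h = b^h *m a^h.
Proof. by rewrite trmx_mul map_mxM. Qed.

Lemma adjmxK m n (a : 'M[C]_(m, n)) : a^h^h = a.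
Proof. by apply/matrixP => i j; rewrite !mxE conjCK. Qed.

Lemma qform_delta d (a : 'M[C]_d) i j :
  qform a (delta_mx i 0) (delta_mx j 0) = a i j.
Proof.
by rewrite /qform trmx_delta map_delta_mx -rowE -colE !mxE.
Qed.

(* Polarization of the form of [a - a^h], which vanishes on the diagonal. *)
Lemma psd_hermitian d (a : 'M[C]_d) : psd a -> a^h = a.
Proof.
move=> a0; apply/eqP; rewrite eq_sym -subr_eq0; set b := a - _.
have b0 v : qform b v v = 0.
  rewrite /b /qform mulmxBr mulmxBl mxE [X in _ + X]mxE.
  have /geC0_conj av := a0 v.
  suff -> : v^h *m a^h *m v = (v^h *m a *m v)^h.
    by rewrite [X in _ - X]mxE [X in (X)^*]mxE av subrr.
  by rewrite !adjmxM adjmxK mulmxA.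
have D u v w : qform b u (v + w) = qform b u v + qform b u w.
  by rewrite /qform mulmxDr mxE.
have D' u v w : qform b (v + w) u = qform b v u + qform b w u.
  rewrite !qformE -big_split; apply: eq_bigr => p _ /=.
  by rewrite mxE rmorphD /= !mulrDl.
have Z z u v : qform b u (z *: v) = z * qform b u v.
  by rewrite /qform -scalemxAr mxE.
have Z' z u v : qform b (z *: v) u = z^* * qform b v u.
  rewrite !qformE mulr_sumr; apply: eq_bigr => p _ /=.
  by rewrite mxE rmorphM /= !mulrA.
apply/eqP/matrixP => i j; rewrite [RHS]mxE -(qform_delta b).
set u := delta_mx i _; set v := delta_mx j _.
have := b0 (u + v); rewrite D !D' !b0 add0r addr0 => e1.
have := b0 (u + 'i *: v); rewrite D !D' !Z !Z' !b0 !mulr0 add0r addr0.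
rewrite conjCi mulNr addrC => /eqP.
rewrite subr_eq0 => /eqP /(mulfI (neq0Ci C)) e2.
by move/eqP: e1; rewrite e2 -mulr2n mulrn_eq0 /= => /eqP.
Qed.

(** By the spectral theorem the columns of [P^h] are orthonormal eigenvectors; scaling each by the
    square root of its eigenvalue absorbs the diagonal factor. *)
Lemma psd_sum_rank1 d (a : 'M[C]_d) :
  psd a -> exists v : 'I_d -> 'cV[C]_d, a = \sum_i v i *m (v i)^h.
Proof.
move=> a0; have ah := psd_hermitian a0.
have /orthomx_spectralP : a \is normalmx.
  by apply/normalmxP; rewrite ah.
set P := spectralmx a; set s := spectral_diag a.
have uP : P \is unitarymx by apply: spectral_unitarymx.
rewrite invmx_unitary // => ea.
have PP : P *m P^h = 1%:M by apply/unitarymxP.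
(* The form of [a] at the i-th eigenvector is the i-th eigenvalue. *)
have s0 i : 0 <= s 0 i.
  have := a0 (P^h *m delta_mx i 0).
  rewrite adjmxM adjmxK [X in _ *m X *m _]ea trmx_delta map_delta_mx.
  rewrite -!mulmxA (mulmxA P) PP mul1mx (mulmxA P) PP mul1mx.
  by rewrite mulmxA -rowE -colE !mxE eqxx.
exists (fun i => sqrtC (s 0 i) *: col i P^h).
apply/matrixP => p q; rewrite {1}ea !mxE summxE; apply: eq_bigr => i _.
rewrite mul_mx_diag !mxE big_ord1 !mxE rmorphM /= conjCK.
rewrite (geC0_conj (_ : 0 <= sqrtC (s 0 i))) ?sqrtC_ge0 //.
by rewrite -{1}[s 0 i]sqrtCK; ring.
Qed.

(** * Coordinate formulas on tensor products *)

Lemma sum_pairACA (I1 I2 J1 J2 : finType)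
    (F : (I1 * I2) * (J1 * J2) -> C) :
  \sum_t F t =
  \sum_(t : (I1 * J1) * (I2 * J2)) F ((t.1.1, t.2.1), (t.1.2, t.2.2)).
Proof.
apply: reindex; exists (fun t => ((t.1.1, t.2.1), (t.1.2, t.2.2)));
  by move=> [[? ?] [? ?]].
Qed.

Lemma sum_mxtens m n (F : 'I_(m * n) -> C) :
  \sum_p F p = \sum_(i : 'I_m * 'I_n) F (idx i).
Proof.
by apply: reindex; exists (@mxtens_unindex m n) => ? _;
  rewrite ?mxtens_indexK ?mxtens_unindexK.
Qed.

Lemma qform_mxtens m n (a : 'M[C]_(m * n)) u v :
  qform a u v = \sum_(p : ('I_m * 'I_n) * ('I_m * 'I_n))
    (u (idx p.1) 0)^* * a (idx p.1) (idx p.2) * v (idx p.2) 0.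
Proof.
rewrite qformE -(pair_bigA _ (fun i j => (u i 0)^* * a i j * v j 0)) /=.
rewrite sum_mxtens -(pair_bigA _ (fun i j =>
  (u (idx i) 0)^* * a (idx i) (idx j) * v (idx j) 0)) /=.
by apply: eq_bigr => i _; rewrite sum_mxtens.
Qed.

Lemma dual_functionalE k h (f : 'M[C]_k -> 'M[C]_h) x :
  dual_functional f x = \sum_(t : ('I_k * 'I_h) * ('I_k * 'I_h))
    x (idx t.1) (idx t.2) * f (delta_mx t.1.1 t.2.1) t.1.2 t.2.2.
Proof.
rewrite /dual_functional.
under eq_bigr do under eq_bigr do rewrite pair_bigA.
(* The definition groups indices by tensor factor, (i, j) and (r, s); from here on they are grouped
   as row (i, r) and column (j, s). *)
rewrite pair_bigA pair_bigA sum_pairACA /=.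
apply: eq_bigr => -[[i r] [j s]] _ /=; congr (_ * _).
(* With the matrix unit split as column times row, cyclicity of the trace isolates the entry (r,
   s). *)
rewrite trmx_delta -[delta_mx s r](mul_delta_mx (0 : 'I_1)) mulmxA.
by rewrite mxtrace_mulC mulmxA -rowE -colE /mxtrace big_ord1 !mxE.
Qed.

Lemma tensor_mapE m n p q (f : 'M[C]_m -> 'M[C]_n)
    (g : 'M[C]_p -> 'M[C]_q) x a b :
  tensor_map f g x (idx a) (idx b) = \sum_(t : ('I_m * 'I_p) * ('I_m * 'I_p))
    x (idx t.1) (idx t.2) * (f (delta_mx t.1.1 t.2.1) a.1 b.1 *
      g (delta_mx t.1.2 t.2.2) a.2 b.2).
Proof.
rewrite /tensor_map summxE.
under eq_bigr do (rewrite summxE; under eq_bigr do (rewrite summxE;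
  under eq_bigr do rewrite summxE; rewrite pair_bigA)).
rewrite pair_bigA pair_bigA sum_pairACA /=.
by apply: eq_bigr => -[[i r] [j s]] _ /=; rewrite !mxE !mxtens_indexK.
Qed.

Lemma qform_ampliation k h (g : 'M[C]_h -> 'M[C]_h) x u v :
  qform (tensor_map (@id 'M[C]_k) g x) u v =
  \sum_(t : ('I_k * 'I_h) * ('I_k * 'I_h)) \sum_(q : 'I_h * 'I_h)
    x (idx t.1) (idx t.2) * g (delta_mx t.1.2 t.2.2) q.1 q.2 *
      ((u (idx (t.1.1, q.1)) 0)^* * v (idx (t.2.1, q.2)) 0).
Proof.
rewrite qform_mxtens.
under eq_bigr do rewrite tensor_mapE mulr_sumr mulr_suml.
rewrite exchange_big; apply: eq_bigr => -[[i r] [j s]] _ /=.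
rewrite sum_pairACA /=.
rewrite -(pair_bigA _ (fun t q => (u (idx (t.1, q.1)) 0)^* *
  (x (idx (i, r)) (idx (j, s)) *
    (delta_mx i j t.1 t.2 * g (delta_mx r s) q.1 q.2)) *
  v (idx (t.2, q.2)) 0)) /=.
(* The identity factor fixes the matrix unit at (i, j), so a single entry of it survives. *)
rewrite (bigD1 (i, j)) //= [X in _ + X]big1 => [|[a b] ne]; last first.
  apply: big1 => q _ /=; rewrite !mxE.
  suff -> : (a == i) && (b == j) = false by rewrite mul0r !mulr0 mul0r.
  by apply: negbTE; rewrite -xpair_eqE.
by rewrite addr0; apply: eq_bigr => q _; rewrite !mxE !eqxx /=; ring.
Qed.

(** The form of the ampliated map at [u] is the form of [x] at [(1 (x) b^h) u], which is the vector
    [y] below. *)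
Lemma cpmaps_congr h (b : 'M[C]_h) : cpmaps (fun x => b *m x *m b^h).
Proof.
split; first by move=> c x y; rewrite mulmxDr mulmxDl -scalemxAr -scalemxAl.
move=> m x x0 u; rewrite -/(qform _ u u) qform_ampliation.
set y : 'cV[C]_(m * h) := \col_p let t := mxtens_unindex p in
  \sum_q (b q t.2)^* * u (idx (t.1, q)) 0.
have := x0 y; rewrite -/(qform x y y) qform_mxtens; congr (0 <= _).
apply: eq_bigr => -[[i r] [j s]] _ /=.
rewrite !mxE !mxtens_indexK /= rmorph_sum /= mulr_suml mulr_suml.
rewrite -(pair_bigA _ (fun q1 q2 => x (idx (i, r)) (idx (j, s)) *
  (b *m delta_mx r s *m b^h) q1 q2 *
  ((u (idx (i, q1)) 0)^* * u (idx (j, q2)) 0))) /=.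
apply: eq_bigr => q1 _; rewrite mulr_sumr; apply: eq_bigr => q2 _.
rewrite -(mul_delta_mx (0 : 'I_1)) mulmxA -mulmxA -colE -rowE.
by rewrite !mxE big_ord1 !mxE rmorphM /= conjCK; ring.
Qed.

(** The index pairs of [g] come out reversed, as in any trace of a product; this is the source of
    the transposition in [qform_slice_right]. *)
Lemma choi_trace h (f g : 'M[C]_h -> 'M[C]_h) :
  \tr (choi f *m choi g) = \sum_(t : ('I_h * 'I_h) * ('I_h * 'I_h))
    f (delta_mx t.1.1 t.2.1) t.1.2 t.2.2 * g (delta_mx t.2.1 t.1.1) t.2.2 t.1.2.
Proof.
have choiE f' (a b : 'I_h * 'I_h) :
    choi f' (idx a) (idx b) = f' (delta_mx a.1 b.1) a.2 b.2.
  rewrite /choi summxE (bigD1 a.1) //= summxE (bigD1 b.1) //=.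
  rewrite !mxE !mxtens_indexK /= !eqxx mul1r.
  rewrite big1 => [|j /negbTE ne]; last first.
    by rewrite !mxE !mxtens_indexK /= [b.1 == j]eq_sym ne andbF mul0r.
  rewrite big1 => [|i /negbTE ne]; first by rewrite !addr0.
  rewrite summxE big1 // => j _.
  by rewrite !mxE !mxtens_indexK /= [a.1 == i]eq_sym ne mul0r.
rewrite /mxtrace sum_mxtens.
rewrite -(pair_bigA _ (fun a b => f (delta_mx a.1 b.1) a.2 b.2 *
  g (delta_mx b.1 a.1) b.2 a.2)).
apply: eq_bigr => a _; rewrite mxE sum_mxtens; apply: eq_bigr => b _.
by rewrite !choiE.
Qed.

(** Meant for members of a mapping cone, which are bare functions with linearity as a
    proposition. *)
Lemma linear_sum_delta m n (f : 'M[C]_m -> 'M[C]_n) a : linear f ->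
  f a = \sum_(p : 'I_m * 'I_m) a p.1 p.2 *: f (delta_mx p.1 p.2).
Proof.
move=> lf; pose F : {linear 'M[C]_m -> 'M[C]_n} :=
  HB.pack f (GRing.isLinear.Build C _ _ *:%R f lf).
rewrite -(pair_bigA _ (fun i j => a i j *: f (delta_mx i j))) /=.
rewrite -[f]/(F : _ -> _) {1}[a]matrix_sum_delta linear_sum.
apply: eq_bigr => i _; rewrite linear_sum; apply: eq_bigr => j _.
exact: linearZ.
Qed.

(* The matrix X of the header: the entries of v v^* and w w^* that belong to f
   are contracted, those belonging to the other tensor factor are left free. *)
Definition slice_left k l h (f : 'M[C]_k -> 'M[C]_h) (v : 'cV[C]_(k * l))
    (w : 'cV[C]_(h * h)) : 'M[C]_(l * h) :=
  \matrix_(p, q) let p := mxtens_unindex p in let q := mxtens_unindex q in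
    \sum_(t : ('I_k * 'I_h) * ('I_k * 'I_h))
      f (delta_mx t.1.1 t.2.1) t.1.2 t.2.2 *
      (v (idx (t.1.1, p.1)) 0 * (w (idx (t.1.2, p.2)) 0)^*) *
      (v (idx (t.2.1, q.1)) 0 * (w (idx (t.2.2, q.2)) 0)^*)^*.

Lemma slice_leftE k l h (f : 'M[C]_k -> 'M[C]_h) (v : 'cV[C]_(k * l)) w p q :
  slice_left f v w (idx p) (idx q) =
    \sum_(t : ('I_k * 'I_h) * ('I_k * 'I_h))
      f (delta_mx t.1.1 t.2.1) t.1.2 t.2.2 *
      (v (idx (t.1.1, p.1)) 0 * (w (idx (t.1.2, p.2)) 0)^*) *
      (v (idx (t.2.1, q.1)) 0 * (w (idx (t.2.2, q.2)) 0)^*)^*.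
Proof. by rewrite mxE !mxtens_indexK. Qed.

(* The matrix Y of the header. *)
Definition slice_right k l h (g : 'M[C]_h -> 'M[C]_h) (v : 'cV[C]_(k * l))
    (w : 'cV[C]_(h * h)) (u : 'cV[C]_(l * h)) : 'M[C]_(k * h) :=
  \matrix_(p, q) let p := mxtens_unindex p in let q := mxtens_unindex q in
    \sum_(t : (('I_l * 'I_h) * ('I_l * 'I_h)) * ('I_h * 'I_h))
      g (delta_mx t.1.1.2 t.1.2.2) t.2.1 t.2.2 *
      (v (idx (p.1, t.1.1.1)) 0 * (w (idx (p.2, t.1.1.2)) 0)^* *
        (u (idx (t.1.1.1, t.2.1)) 0)^*) *
      (v (idx (q.1, t.1.2.1)) 0 * (w (idx (q.2, t.1.2.2)) 0)^* *
        (u (idx (t.1.2.1, t.2.2)) 0)^*)^*.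

Lemma slice_rightE k l h (g : 'M[C]_h -> 'M[C]_h) (v : 'cV[C]_(k * l)) w
    (u : 'cV[C]_(l * h)) p q :
  slice_right g v w u (idx p) (idx q) =
    \sum_(t : (('I_l * 'I_h) * ('I_l * 'I_h)) * ('I_h * 'I_h))
      g (delta_mx t.1.1.2 t.1.2.2) t.2.1 t.2.2 *
      (v (idx (p.1, t.1.1.1)) 0 * (w (idx (p.2, t.1.1.2)) 0)^* *
        (u (idx (t.1.1.1, t.2.1)) 0)^*) *
      (v (idx (q.1, t.1.2.1)) 0 * (w (idx (q.2, t.1.2.2)) 0)^* *
        (u (idx (t.1.2.1, t.2.2)) 0)^*)^*.
Proof. by rewrite mxE !mxtens_indexK. Qed.

(** * Moving the form from one map to the other *)

Lemma qform_tensor_map k l h (f : 'M[C]_k -> 'M[C]_h)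
    (g : 'M[C]_l -> 'M[C]_h) v w :
  qform (tensor_map f g (v *m v^h)) w w = dual_functional g (slice_left f v w).
Proof.
rewrite qform_mxtens dual_functionalE.
under eq_bigr do rewrite tensor_mapE mulr_sumr mulr_suml.
under [RHS]eq_bigr do rewrite slice_leftE mulr_suml.
rewrite !pair_bigA /=.
(* The left side groups the eight indices by vector, [w] then [v]; the right side groups them by
   map, [g] with r, c, s, d and [f] with i, a, j, b. *)
pose to (z : (('I_l * 'I_h) * ('I_l * 'I_h)) *
    (('I_k * 'I_h) * ('I_k * 'I_h))) :=
  let: (((r, c), (s, d)), ((i, a), (j, b))) := z in
  (((a, c), (b, d)), ((i, r), (j, s))).
pose fro (z : (('I_h * 'I_h) * ('I_h * 'I_h)) *
    (('I_k * 'I_l) * ('I_k * 'I_l))) :=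
  let: (((a, c), (b, d)), ((i, r), (j, s))) := z in
  (((r, c), (s, d)), ((i, a), (j, b))).
rewrite (reindex to) /=; last first.
  by exists fro => -[[[? ?] [? ?]] [[? ?] [? ?]]] _.
apply: eq_bigr => -[[[r c] [s d]] [[i a] [j b]]] _ /=.
by rewrite !mxE big_ord1 !mxE !rmorphM /= conjCK; ring.
Qed.

(** Exchange of summation: once the entries of [f] are pulled out, the remaining contraction of [g]
    with [u], [v] and [w] is an entry of [slice_right]. *)
Lemma qform_slice_left k l h (f : 'M[C]_k -> 'M[C]_h) (g : 'M[C]_h -> 'M[C]_h)
    (v : 'cV[C]_(k * l)) w u :
  qform (tensor_map id g (slice_left f v w)) u u =
  dual_functional f (slice_right g v w u).
Proof.
rewrite qform_ampliation dual_functionalE pair_bigA /=.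
under eq_bigr do rewrite slice_leftE -mulrA mulr_suml.
under [RHS]eq_bigr do rewrite slice_rightE mulr_suml.
rewrite [RHS]exchange_big.
apply: eq_bigr => -[[[r c] [s d]] [e1 e2]] _ /=.
apply: eq_bigr => -[[i a] [j b]] _ /=.
by rewrite !rmorphM /= !conjCK; ring.
Qed.

(** The vector [w] links the inputs of [f] and [g], while [v], [u] and [p] together link their
    outputs. Each link occurs once plain and once conjugated, hence acts as a congruence, by [W]
    before and by [T^h] after the transposed [f]. The form [T^h^h] fits [mapping_cone_congr]. *)
Lemma qform_slice_right k l h (f g : 'M[C]_h -> 'M[C]_h) (v : 'cV[C]_(k * l))
    (w : 'cV[C]_(h * h)) (u : 'cV[C]_(l * h)) (p : 'cV[C]_(k * h))
    (W := \matrix_(a, c) w (idx (a, c)) 0 : 'M[C]_h)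
    (T := \matrix_(a, e) \sum_(z : 'I_k * 'I_l)
       v (idx z) 0 * (u (idx (z.2, e)) 0)^* * (p (idx (z.1, a)) 0)^*
       : 'M[C]_h) :
  linear f ->
  qform (tensor_map id f (slice_right g v w u)) p p =
  \tr (choi g *m choi (fun x =>
    T^h *m transpose_map f (W *m x *m W^h) *m T^h^h)).
Proof.
move=> lf; rewrite qform_ampliation choi_trace adjmxK.
(* The transpose puts the conjugate on the row index, where [slice_right] has it. *)
have WE c d : (W *m delta_mx d c *m W^h)^T =
    \matrix_(a, b) ((w (idx (a, c)) 0)^* * w (idx (b, d)) 0).
  apply/matrixP => a b; rewrite mxE -(mul_delta_mx (0 : 'I_1)) mulmxA -mulmxA.
  by rewrite -colE -rowE !mxE big_ord1 !mxE mulrC.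
have E c d e1 e2 :
    (T^h *m transpose_map f (W *m delta_mx d c *m W^h) *m T) e2 e1 =
    \sum_(q : ('I_h * 'I_h) * ('I_h * 'I_h)) (T q.2.2 e2)^* * T q.2.1 e1 *
      ((w (idx (q.1.1, c)) 0)^* * w (idx (q.1.2, d)) 0) *
      f (delta_mx q.1.1 q.1.2) q.2.1 q.2.2.
  rewrite -(pair_bigA _ (fun x y => (T y.2 e2)^* * T y.1 e1 *
      ((w (idx (x.1, c)) 0)^* * w (idx (x.2, d)) 0) *
      f (delta_mx x.1 x.2) y.1 y.2)) /=.
  rewrite /transpose_map WE (linear_sum_delta _ lf) exchange_big.
  rewrite -(pair_bigA _ (fun a b => \sum_i (T b e2)^* * T a e1 *
      ((w (idx (i.1, c)) 0)^* * w (idx (i.2, d)) 0) *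
      f (delta_mx i.1 i.2) a b)) /=.
  rewrite mxE; apply: eq_bigr => a _; rewrite mxE mulr_suml.
  apply: eq_bigr => b _; rewrite [X in _ * X * _]mxE summxE mulr_sumr mulr_suml.
  by apply: eq_bigr => q _; rewrite [X in _ * X * _ = _]mxE !mxE; ring.
under [RHS]eq_bigr do rewrite E mulr_sumr.
rewrite pair_bigA [RHS]pair_bigA /=.
under eq_bigr do rewrite slice_rightE -mulrA mulr_suml.
under [RHS]eq_bigr do
  rewrite !mxE rmorph_sum /= big_distrlr pair_bigA !mulr_suml mulr_sumr /=.
rewrite !pair_bigA /=.
(* Twelve indices: the right side lists those of [g], those of [f], then the ones summed in the two
   copies of [T]. The pair (j, s) comes first because the conjugated copy does in [E]. *)
pose to (z : ((('I_h * 'I_h) * ('I_h * 'I_h)) * (('I_h * 'I_h) * ('I_h * 'I_h)))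
     * (('I_k * 'I_l) * ('I_k * 'I_l))) :
   ((('I_k * 'I_h) * ('I_k * 'I_h)) * ('I_h * 'I_h)) *
   ((('I_l * 'I_h) * ('I_l * 'I_h)) * ('I_h * 'I_h)) :=
  let: ((((c, e), (d, f)), ((a, b), (x, y))), ((j, s), (i, r))) := z in
  ((((i, a), (j, b)), (x, y)), (((r, c), (s, d)), (e, f))).
pose fro (z : ((('I_k * 'I_h) * ('I_k * 'I_h)) * ('I_h * 'I_h)) *
   ((('I_l * 'I_h) * ('I_l * 'I_h)) * ('I_h * 'I_h))) :=
  let: ((((i, a), (j, b)), (x, y)), (((r, c), (s, d)), (e, f))) := z in
  ((((c, e), (d, f)), ((a, b), (x, y))), ((j, s), (i, r))).
rewrite (reindex to) /=; last first.
  exists fro.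
    by move=> [[[[? ?] [? ?]] [[? ?] [? ?]]] [[? ?] [? ?]]] _.
  by move=> [[[[? ?] [? ?]] [? ?]] [[[? ?] [? ?]] [? ?]]] _.
apply: eq_bigr => -[[[[c e1] [d e2]] [[a b] [x y]]] [[j s] [i r]]] _ /=.
by rewrite !rmorphM /= !conjCK; ring.
Qed.

(** * Mapping cones and positivity of the tensor product *)

Lemma mapping_cone_congr h (D : set ('M[C]_h -> 'M[C]_h)) f (a b : 'M[C]_h) :
  mapping_cone D -> D f -> D (fun x => b *m f (a *m x *m a^h) *m b^h).
Proof.
move=> [_ Dcp] Df; have [_ Dfa] := Dcp _ _ Df (cpmaps_congr a).
by have [] := Dcp _ _ Dfa (cpmaps_congr b).
Qed.

(** Lets [linear_sum] reduce positivity to the rank-one summands. *)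
HB.instance Definition _ m n p q (f : 'M[C]_m -> 'M[C]_n)
    (g : 'M[C]_p -> 'M[C]_q) :=
  GRing.isLinear.Build C _ _ *:%R (tensor_map f g) (tensor_map_linear f g).

Lemma tensor_map_positive k l h (D : set ('M[C]_h -> 'M[C]_h))
    (f : 'M[C]_k -> 'M[C]_h) (g : 'M[C]_l -> 'M[C]_h) :
  mapping_cone D -> symmetric_cone D ->
  cone_positive D f -> cone_positive (dual_cone D) g ->
  positive_map (tensor_map f g).
Proof.
move=> Dcone Dsym f_pos g_pos a /psd_sum_rank1[v ->].
rewrite linear_sum => w.
rewrite mulmx_sumr mulmx_suml summxE sumr_ge0 // => i _.
rewrite -/(qform _ w w) qform_tensor_map; apply: g_pos => g' [_ dual_g'] u.
rewrite -/(qform _ u u) qform_slice_left; apply: f_pos => f' Df' p.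
have lf' : linear f' by have [[Dpos _ _ _ _] _] := Dcone; case: (Dpos _ Df').
rewrite -/(qform _ p p) qform_slice_right //; apply: dual_g'.
(* The two test maps [g'] and [f'] now meet in one Choi pairing; it remains to see that the modified
   [f'] is still in [D]. *)
have /(Dsym _ lf').2 Dtf' := Df'.
exact: (mapping_cone_congr _ _ Dcone).
Qed.

End MappingCones.

Local Open Scope complex_scope.

Theorem corollary3 (R : realType) (k l h : nat)
    (D : set ('M[R[i]]_h -> 'M[R[i]]_h))
    (psi : {linear 'M[R[i]]_k -> 'M[R[i]]_h})
    (phi : {linear 'M[R[i]]_l -> 'M[R[i]]_h}) :
  mapping_cone D -> symmetric_cone D ->
  cone_positive D psi -> cone_positive (dual_cone D) phi ->
  positive_map (tensor_map psi phi).
Proof. exact: tensor_map_positive. Qed.
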